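(* Let $G$ and $G'$ be graphs on the vertex set $\{1,\dots,n\}$ with adjacency matrices $\Gamma$ and $\Gamma'$ (over $\mathbb{F}_2$), respectively. Then $G$ and $G'$ are edge-locally equivalent if and only if there exists $H\in\mathcal{H}_n$ such that $\Gamma\in\Delta(H)$ and $H(\Gamma)=\Gamma'$.
   Context: All matrices are over $\mathbb{F}_2$. Graphs are finite, undirected and simple with vertex set $V=\{1,\dots,n\}$; an adjacency matrix is a symmetric matrix over $\mathbb{F}_2$ with zero diagonal. Local complementation: for a vertex $i$, $G*i$ is the graph on $V$ obtained from $G$ by replacing the subgraph induced on the neighborhood $N(i)$ by its complement and leaving the rest unchanged. For an edge $e=\{i,j\}$ of $G$, the edge-local complement is $G*e=((G*i)*j)*i=((G*j)*i)*j$. Two graphs $G,G'$ on $V$ are edge-locally equivalent if there is a finite (possibly empty) sequence $e_1,\dots,e_N$ of 2-element subsets of $V$ such that $e_1$ is an edge of $G$, $e_\alpha$ is an edge of $((G*e_1)*\dots)*e_{\alpha-1}$ for $\alpha=2,\dots,N$, and $((G*e_1)*\dots)*e_N=G'$. Linear fractional transformations: $\mathcal{C}_n$ is the group of all nonsingular $2n\times 2n$ matrices $Q=\left[\begin{array}{cc}A&B\\C&D\end{array}\right]$, written $Q=[A,B,C,D]$, with $A,B,C,D$ diagonal $n\times n$ matrices (equivalently $AD+BC=I$). When $C\Gamma+D$ is nonsingular, $Q(\Gamma)=(A\Gamma+B)(C\Gamma+D)^{-1}$. The domain $\Delta(Q)$ is the set of all $n\times n$ adjacency matrices $\Gamma$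 such that $C\Gamma+D$ is nonsingular and $Q(\Gamma)$ has zero diagonal. $\mathcal{H}_n\subseteq\mathcal{C}_n$ is the subgroup of all $H^A:=[A+I,A,A,A+I]$ with $A$ a diagonal $n\times n$ matrix. *)

(* Defs.v *)
From HB Require Import structures.
From mathcomp Require Import all_boot all_algebra.

Set Implicit Arguments.
Unset Strict Implicit.
Unset Printing Implicit Defensive.

Import GRing.Theory.
Local Open Scope ring_scope.

(* The vertex set {1, ..., n} is 'I_n, and edges are 2-element sets of
   vertices, so that Leibniz equality of graphs is equality of edge sets. *)
Record graph (n : nat) := Graph {
  edges : {set {set 'I_n}};
  edges_card2 : [forall e in edges, #|e| == 2%N]
}.

HB.instance Definition _ n := [isSub for @edges n].

Section LocalComplementation.

Variable n : nat.
Implicit Types (G : graph n) (i j x y : 'I_n) (e : {set 'I_n}).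

Definition adj G : rel 'I_n := fun x y => [set x; y] \in edges G.

Definition neighborhood G i : {set 'I_n} := [set x | adj G i x].

Definition lc_edges G i : {set {set 'I_n}} :=
  [set e : {set 'I_n} |
    (e \in edges G) (+) ((#|e| == 2%N) && (e \subset neighborhood G i))].

Fact lc_edges_card2 G i : [forall e in lc_edges G i, #|e| == 2%N].
Proof.
apply/forall_inP=> e; rewrite inE.
case eG: (e \in edges G) => /=; last by case/andP.
by move=> _; exact: (forall_inP (edges_card2 G)).
Qed.

Definition local_compl G i : graph n := Graph (lc_edges_card2 G i).

(* G * e for an edge e = {i, j}. The enumeration of e orders its endpoints,
   but the order is irrelevant by edge_local_complE below. The value G when e
   is not a pair is a dummy. *)
Definition edge_local_compl G e : graph n :=
  if enum e is [:: i; j] then local_compl (local_compl (local_compl G i) j) i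
  else G.

Fixpoint elc_path G (s : seq {set 'I_n}) (G' : graph n) : Prop :=
  if s is e :: s' then e \in edges G /\ elc_path (edge_local_compl G e) s' G'
  else G = G'.

Definition edge_locally_equivalent G (G' : graph n) : Prop :=
  exists s : seq {set 'I_n}, elc_path G s G'.

Lemma adjC G x y : adj G x y = adj G y x.
Proof. by rewrite /adj setUC. Qed.

Lemma adjxx G x : adj G x x = false.
Proof.
apply/negP=> /(forall_inP (edges_card2 G)).
by rewrite setUid cards1.
Qed.

Lemma adj_local_compl G i x y :
  adj (local_compl G i) x y =
    adj G x y (+) [&& x != y, adj G i x & adj G i y].
Proof.
rewrite /adj /= inE cards2 subUset !sub1set !inE.
by case: (x =P y).
Qed.

Lemma graph_eqP G (G' : graph n) : adj G =2 adj G' -> G = G'.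
Proof.
move=> eqGG'; apply: val_inj; apply/setP=> e /=.
case e2: (#|e| == 2%N).
  by have /cards2P[x [y [_ ->]]] := e2; exact: eqGG'.
apply/idP/idP => /(forall_inP (edges_card2 _)); by rewrite e2.
Qed.

Lemma edge_local_compl_sym G i j : adj G i j ->
  local_compl (local_compl (local_compl G i) j) i =
  local_compl (local_compl (local_compl G j) i) j.
Proof.
move=> Gij; have Gji: adj G j i by rewrite adjC.
have nij: i != j by apply/eqP=> eij; rewrite eij adjxx in Gij.
apply: graph_eqP => x y; rewrite !adj_local_compl.
have nji: j != i by rewrite eq_sym.
rewrite !adjxx Gij Gji nij nji.
case: (eqVneq x y) => [->|nxy]; first by rewrite !andbF.
case: (eqVneq i x) => [ex|nix]; case: (eqVneq j x) => [fx|njx];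
case: (eqVneq i y) => [ey|niy]; case: (eqVneq j y) => [fy|njy];
try subst x; try subst y; rewrite ?fx ?fy ?eqxx // in nij nji nxy *;
rewrite ?(adjC G x i) ?(adjC G x j) ?(adjC G x y) ?adjxx ?Gij ?Gji //=;
by do ?[case: (adj G _ _) => //=].
Qed.

Lemma edge_local_complE G i j : adj G i j ->
  edge_local_compl G [set i; j] =
  local_compl (local_compl (local_compl G i) j) i.
Proof.
move=> Gij.
have nij: i != j by apply/eqP=> eij; rewrite eij adjxx in Gij.
have : perm_eq (enum [set i; j]) [:: i; j].
  apply: uniq_perm; rewrite ?enum_uniq //= ?inE ?nij //.
  by move=> x; rewrite mem_enum !inE.
rewrite /edge_local_compl => eqe.
have: size (enum [set i; j]) = 2%N by rewrite (perm_size eqe).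
case: (enum _) eqe => [|a [|b []]] //= eqe _.
have: a \in [:: i; j] by rewrite -(perm_mem eqe) inE eqxx.
have: b \in [:: i; j] by rewrite -(perm_mem eqe) !inE eqxx orbT.
have: a != b by have := perm_uniq eqe; rewrite /= !inE nij /= andbT => ->.
rewrite !inE => nab /pred2P[] eb /pred2P[] ea; subst a b;
  rewrite ?eqxx // in nab *.
by rewrite -edge_local_compl_sym.
Qed.

End LocalComplementation.

Definition adjmx n (G : graph n) : 'M['F_2]_n :=
  \matrix_(i, j) (adj G i j)%:R.

Definition zero_diag n (M : 'M['F_2]_n) : bool := [forall i, M i i == 0].

Definition is_adjmx n (M : 'M['F_2]_n) : bool := (M^T == M) && zero_diag M.

Definition Cn n : {set 'M['F_2]_(n + n)} :=
  [set Q | [&& Q \in unitmx, is_diag_mx (ulsubmx Q), is_diag_mx (ursubmx Q),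
               is_diag_mx (dlsubmx Q) & is_diag_mx (drsubmx Q)]].

(* Only meaningful when C *m M + D is invertible. *)
Definition lft n (Q : 'M['F_2]_(n + n)) (M : 'M['F_2]_n) : 'M['F_2]_n :=
  (ulsubmx Q *m M + ursubmx Q) *m invmx (dlsubmx Q *m M + drsubmx Q).

Definition lft_domain n (Q : 'M['F_2]_(n + n)) : {set 'M['F_2]_n} :=
  [set M | [&& is_adjmx M, dlsubmx Q *m M + drsubmx Q \in unitmx
             & zero_diag (lft Q M)]].

Definition Hmx n (A : 'M['F_2]_n) : 'M['F_2]_(n + n) :=
  block_mx (A + 1%:M) A A (A + 1%:M).

Definition Hn n : {set 'M['F_2]_(n + n)} :=
  [set Hmx A | A : 'M['F_2]_n & is_diag_mx A].

Lemma F2_addrr n (A : 'M['F_2]_n) : A + A = 0.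
Proof.
apply/matrixP=> i j; rewrite !mxE.
by case: (A i j) => [[|[|]]] //= ?; apply: val_inj.
Qed.

Lemma HmxM n (A B : 'M['F_2]_n) : Hmx A *m Hmx B = Hmx (A + B).
Proof.
rewrite /Hmx mulmx_block !mulmxDl !mulmxDr !mul1mx !mulmx1.
have XX (X Y : 'M['F_2]_n) : X + (X + Y) = Y by rewrite addrA F2_addrr add0r.
congr block_mx.
- by rewrite addrC -!addrA XX.
- by rewrite addrACA F2_addrr add0r addrC.
- by rewrite addrACA F2_addrr add0r.
by rewrite -!addrA XX.
Qed.

Lemma Hmx0 n : Hmx (0 : 'M['F_2]_n) = 1%:M.
Proof. by rewrite /Hmx add0r -scalar_mx_block. Qed.

Lemma HmxK n (A : 'M['F_2]_n) : Hmx A *m Hmx A = 1%:M.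
Proof. by rewrite HmxM F2_addrr Hmx0. Qed.

Lemma Hn_sub_Cn n : Hn n \subset Cn n.
Proof.
apply/subsetP=> _ /imsetP[A Adiag ->]; rewrite inE in Adiag.
have AIdiag : is_diag_mx (A + 1%:M).
  have /is_diag_mxP Ad := Adiag; apply/is_diag_mxP=> i j nij.
  by rewrite !mxE Ad // -val_eqE (negPf nij) add0r.
rewrite inE /Hmx block_mxKul block_mxKur block_mxKdl block_mxKdr.
by rewrite Adiag AIdiag !andbT; case/mulmx1_unit: (HmxK A).
Qed.

(* Main.v *)
(* [H^A] swaps, on the support S of A, the coordinates of the pair (x, y) when
   y = Gamma x: it is the principal pivot transform on S. Pivots on S and T
   compose to the pivot on their symmetric difference, and the pivot on an edge
   {i, j} is edge-local complementation. If the pivot on a nonempty S is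
   defined, then the graph has an edge inside S (otherwise the denominator has
   a zero column), and pivoting on it leaves a pivot on the smaller set
   S minus {i, j}. *)
Require Import Defs.
From mathcomp Require Import all_boot all_algebra.

Set Implicit Arguments.
Unset Strict Implicit.
Unset Printing Implicit Defensive.

Import GRing.Theory.
Local Open Scope ring_scope.

Section Pivot.

Variable n : nat.
Implicit Types (A B X Y Z M N P : 'M['F_2]_n) (S T : {set 'I_n}).
Implicit Types (G : graph n) (x y i j : 'I_n).

(* For a diagonal 0/1 matrix A: the rows of X in the support of A, and those of
   Y elsewhere. *)
Definition blend A X Y := A *m X + (A + 1%:M) *m Y.

Lemma blendE A X Y : blend A X Y = Y + A *m (X + Y).
Proof. by rewrite /blend mulmxDl mul1mx mulmxDr addrA addrC. Qed.

Lemma blend_mulmx A X Y Z : blend A X Y *m Z = blend A (X *m Z) (Y *m Z).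
Proof. by rewrite /blend mulmxDl !mulmxA. Qed.

(** The two inner blends sum to [X + Y], because [B *m (X + Y)] occurs twice and cancels in
    characteristic 2. For 0/1 diagonals, a row is swapped once by each of [A] and [B] that selects
    it. *)
Lemma blend_blend A B X Y :
  blend A (blend B X Y) (blend B Y X) = blend (A + B) Y X.
Proof.
rewrite !blendE (addrC Y X) (addrACA Y) (addrC Y X) F2_addrr addr0.
by rewrite mulmxDl -addrA (addrC (B *m _)).
Qed.

(* N = H^A(M), cleared of the denominator A M + A + I, which is then
   automatically invertible (pivot_unitmx). *)
Definition pivot A M N := N *m blend A M 1%:M = blend A 1%:M M.

(** Cocycle rule for denominators: right multiplication by the denominator at [M] turns the pair
    ([N], [1%:M]) into the two opposite blends of [M] and [1%:M], which [blend_blend] merges. *)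
Lemma blend_pivot A B M N : pivot A M N ->
  blend B N 1%:M *m blend A M 1%:M = blend (B + A) M 1%:M.
Proof. by move=> MN; rewrite blend_mulmx MN mul1mx blend_blend. Qed.

Lemma pivot_comp A B M N P :
  pivot A M N -> pivot B N P -> pivot (B + A) M P.
Proof.
move=> MN NP; rewrite /pivot -(blend_pivot B MN) mulmxA NP.
by rewrite blend_mulmx MN mul1mx blend_blend.
Qed.

(** Taking [B = A] in the cocycle rule makes the product of the two denominators the identity. *)
Lemma pivot_unitmx A M N : pivot A M N -> blend A M 1%:M \in unitmx.
Proof.
move=> /(blend_pivot A); rewrite F2_addrr (blendE 0) mul0mx addr0.
by case/mulmx1_unit.
Qed.

(** Strips off a pivot already performed: the equation for [N] and [P] may be checked after
    multiplying by the invertible denominator at [M]. *)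
Lemma pivot_cancel A B M N P :
  pivot A M N -> pivot (B + A) M P -> pivot B N P.
Proof.
move=> MN MP; apply: (can_inj (mulmxK (pivot_unitmx MN))).
by rewrite -mulmxA (blend_pivot _ MN) MP blend_mulmx MN mul1mx blend_blend.
Qed.

Lemma pivot0 M N : pivot 0 M N <-> M = N.
Proof.
by rewrite /pivot !blendE !mul0mx !addr0 mulmx1; split=> ->.
Qed.

Lemma adjmx_zero_diag G : zero_diag (adjmx G).
Proof. by apply/forallP=> i; rewrite mxE adjxx. Qed.

Lemma adjmx_is_adjmx G : is_adjmx (adjmx G).
Proof.
rewrite /is_adjmx adjmx_zero_diag andbT; apply/eqP/matrixP=> i j.
by rewrite !mxE adjC.
Qed.

Lemma adjmx_inj : injective (@adjmx n).
Proof.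
move=> G G' /matrixP eqGG'; apply: graph_eqP => i j.
by have := eqGG' i j; rewrite !mxE; do 2![case: adj].
Qed.

Lemma pivot_lft A G G' :
  pivot A (adjmx G) (adjmx G') <->
  adjmx G \in lft_domain (Hmx A) /\ lft (Hmx A) (adjmx G) = adjmx G'.
Proof.
have denE M : dlsubmx (Hmx A) *m M + drsubmx (Hmx A) = blend A M 1%:M.
  by rewrite /Hmx block_mxKdl block_mxKdr /blend mulmx1.
have numE M : ulsubmx (Hmx A) *m M + ursubmx (Hmx A) = blend A 1%:M M.
  by rewrite /Hmx block_mxKul block_mxKur /blend mulmx1 addrC.
rewrite inE /lft denE numE; split=> [GG' | [/and3P[_ uG _] <-]].
  rewrite -GG' mulmxK ?(pivot_unitmx GG') //.
  by rewrite adjmx_is_adjmx adjmx_zero_diag.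
by rewrite /pivot mulmxKV.
Qed.

Definition set_mx S : 'M['F_2]_n := diag_mx (\row_i (i \in S)%:R).

Lemma set_mx_diag S : is_diag_mx (set_mx S).
Proof. exact: diag_mx_is_diag. Qed.

(** The only nonzero scalar of ['F_2] is 1, so a diagonal matrix is determined by its support. *)
Lemma diag_set_mx A : is_diag_mx A -> A = set_mx [set i | A i i != 0].
Proof.
move=> /is_diag_mxP Ad; apply/matrixP=> i j; rewrite !mxE inE.
have [<-|nij] := eqVneq i j; last by rewrite Ad.
by case: (A i i) => [[|[|]]] //= ?; apply: val_inj.
Qed.

Lemma set_mx0 : set_mx set0 = 0.
Proof. by apply/matrixP=> i j; rewrite !mxE inE mul0rn. Qed.

Lemma set_mxD S T : T \subset S -> set_mx S = set_mx (S :\: T) + set_mx T.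
Proof.
move=> sTS; apply/matrixP=> i j; rewrite !mxE inE -mulrnDl; congr (_ *+ _).
have [/(subsetP sTS)->|_] := boolP (i \in T); first by rewrite add0r.
by rewrite addr0.
Qed.

Lemma blend_set_mxE S X Y x y :
  blend (set_mx S) X Y x y = if x \in S then X x y else Y x y.
Proof.
rewrite blendE mxE mul_diag_mx !mxE; case: ifP => _.
  have /matrixP/(_ x y) := F2_addrr Y.
  by rewrite mul1r addrCA !mxE => ->; rewrite addr0.
by rewrite mul0r addr0.
Qed.

Lemma natr_addb (b c : bool) : (b (+) c)%:R = b%:R + c%:R :> 'F_2.
Proof. by case: b; case: c; apply: val_inj. Qed.

Lemma pivot_edge G i j : adj G i j ->
  pivot (set_mx [set i; j]) (adjmx G) (adjmx (edge_local_compl G [set i; j])).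
Proof.
move=> Gij; rewrite (edge_local_complE Gij).
have Gji : adj G j i by rewrite adjC.
have nij : i != j by apply/eqP=> eij; rewrite eij adjxx in Gij.
have nji : j != i by rewrite eq_sym.
set G' := local_compl _ i; apply/matrixP=> x y.
rewrite blend_set_mxE mxE (bigD1 i) //= (bigD1 j) //=.
rewrite !blend_set_mxE !inE !eqxx orbT /=.
(* Outside [i] and [j] the denominator has identity rows, so only the term [k = y] can survive, and
   it is absent when [y] is an endpoint. *)
have -> : \sum_(k | (k != i) && (k != j)) adjmx G' x k *
    blend (set_mx [set i; j]) (adjmx G) 1%:M k y =
    ((y \notin [set i; j]) && adj G' x y)%:R.
  have blend_row k : (k != i) && (k != j) ->
      blend (set_mx [set i; j]) (adjmx G) 1%:M k y = (k == y)%:R.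
    by rewrite blend_set_mxE !inE !mxE -negb_or => /negPf->.
  under eq_bigr => k kP do rewrite (blend_row k kP) mxE.
  rewrite !inE negb_or; have [yP|yP] /= := boolP ((y != i) && (y != j)).
    rewrite (bigD1 y) //= eqxx mulr1 big1 ?addr0 // => k /andP[_ /negPf->].
    by rewrite mulr0.
  rewrite big1 // => k kP; have [eky|_] := eqVneq k y; last by rewrite mulr0.
  by rewrite -eky kP in yP.
(* Products become conjunctions and sums exclusive ors, leaving a Boolean identity to check by the
   positions of [x] and [y] relative to [i] and [j]. *)
rewrite !mxE !inE -!natrM !mulnb -!natr_addb -(fun_if (fun b : bool => b%:R)).
congr (nat_of_bool _)%:R.
rewrite /G' !adj_local_compl !adjxx Gij Gji nij nji !eqxx.
have [->|nxi] := eqVneq x i; last have [->|nxj] := eqVneq x j;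
  (have [->|_] := eqVneq y i; last have [->|_] := eqVneq y j);
  rewrite ?adjxx ?Gij ?Gji ?eqxx ?(negPf nij) ?(negPf nji)
          ?(negPf nxi) ?(negPf nxj) /=;
  rewrite ?(adjC G x i) ?(adjC G x j) //=;
  try have [->|_] := eqVneq x y; rewrite ?adjxx /=;
  by case: (adj G i x); case: (adj G j x); case: (adj G i y); case: (adj G j y);
     case: (adj G x y).
Qed.

Lemma pivot_has_edge S M N : pivot (set_mx S) M N -> S != set0 ->
  exists i j, [/\ i \in S, j \in S & M i j != 0].
Proof.
move=> MN /set0Pn[j jS].
have [/exists_inP[i iS Mij]|/exists_inPn M0] :=
  boolP [exists i in S, M i j != 0]; first by exists i, j.
(* In column [j], rows in [S] carry entries of [M], all zero by [M0]; the other rows come from the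
   identity and miss its diagonal, as [j] is in [S]. *)
have col0 : blend (set_mx S) M 1%:M *m delta_mx j 0 = 0 :> 'cV_n.
  apply/matrixP=> i k; rewrite -colE [LHS]mxE [RHS]mxE blend_set_mxE mxE.
  have [/M0|iNS] := boolP (i \in S); first by rewrite negbK => /eqP.
  by have [eij|//] := eqVneq i j; rewrite eij jS in iNS.
have /matrixP/(_ j 0) : delta_mx j 0 = 0 :> 'cV['F_2]_n.
  by rewrite -(mulKmx (pivot_unitmx MN) (delta_mx j 0)) col0 mulmx0.
by rewrite !mxE !eqxx.
Qed.

Lemma elc_path_pivot (s : seq {set 'I_n}) G G' : elc_path G s G' ->
  exists A, is_diag_mx A /\ pivot A (adjmx G) (adjmx G').
Proof.
elim: s G => [|e s IHs] G /=.
  by move=> <-; exists 0; split; [exact: mx0_is_diag | exact/pivot0].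
case=> eG /IHs[A [Adiag GG']].
have /cards2P[i [j [_ ij]]] := forall_inP (edges_card2 G) e eG; subst e.
exists (A + set_mx [set i; j]); split; last exact: pivot_comp (pivot_edge eG) GG'.
have /is_diag_mxP Ad := Adiag; have /is_diag_mxP Ed := set_mx_diag [set i; j].
by apply/is_diag_mxP=> x y nxy; rewrite mxE Ad ?Ed ?addr0.
Qed.

Lemma pivot_edge_locally_equivalent S G G' :
  pivot (set_mx S) (adjmx G) (adjmx G') -> edge_locally_equivalent G G'.
Proof.
(* Strong induction on the size of [S], with [G] generalized because each step replaces it by an
   edge-local complement. *)
have [m] := ubnP #|S|; elim: m S G => // m IHm S G; rewrite ltnS => leSm GG'.
have [S0|/(pivot_has_edge GG')] := eqVneq S set0.
  by exists nil; apply/adjmx_inj/pivot0; rewrite -set_mx0 -S0.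
case=> i [j [iS jS]]; rewrite mxE => Gij0.
have Gij : adj G i j by case: adj Gij0.
have sijS : [set i; j] \subset S by rewrite subUset !sub1set iS.
rewrite (set_mxD sijS) in GG'.
have [|s Gs] := IHm _ _ _ (pivot_cancel (pivot_edge Gij) GG').
  apply: leq_trans leSm; apply: proper_card; apply/properP.
  by split; [exact: subsetDl | exists i; rewrite ?inE ?eqxx].
by exists ([set i; j] :: s); split.
Qed.

End Pivot.

Theorem theorem2 (n : nat) (G G' : graph n) :
  edge_locally_equivalent G G' <->
  exists H : 'M['F_2]_(n + n),
    [/\ H \in Hn n, adjmx G \in lft_domain H & lft H (adjmx G) = adjmx G'].
Proof.
split=> [[s /elc_path_pivot[A [Adiag /pivot_lft[GH eGG']]]] | [H [/imsetP[A]]]].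
  by exists (Hmx A); split=> //; apply: imset_f; rewrite inE.
rewrite inE => Adiag -> GH eGG'.
apply: (@pivot_edge_locally_equivalent _ [set i | A i i != 0]).
by rewrite -diag_set_mx //; apply/pivot_lft.
Qed.
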